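(* Let $n\geq 1$ be an integer and let $p_1,\dots,p_n$ be distinct prime numbers, none of which is $2$ or $3$. Put $\hat p=p_1p_2\cdots p_n$, and suppose that $$\hat q=2^{\hat p}-1=q_1q_2\cdots q_m\qquad\text{and}\qquad \hat r=\frac{2^{\hat p}+1}{3}=r_1r_2\cdots r_k,$$ where $q_1,\dots,q_m,r_1,\dots,r_k$ are pairwise distinct prime numbers, all different from $2$, from $3$, and from each of $p_1,\dots,p_n$. Then there exists a finite solvable group $G$ whose prime character degree graph $\Delta(G)$ is the following graph on $n+m+k+2$ vertices: the vertex set is $$\{2,3\}\cup\{p_1,\dots,p_n\}\cup\{q_1,\dots,q_m\}\cup\{r_1,\dots,r_k\},$$ and two distinct vertices are adjacent if and only if both lie in $\{2,p_1,\dots,p_n,q_1,\dots,q_m\}$ or both lie in $\{3,r_1,\dots,r_k,q_1,\dots,q_m\}$.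
   Context: For a finite group $G$, $\operatorname{Irr}(G)$ denotes the set of irreducible complex characters of $G$ and $\operatorname{cd}(G)=\{\chi(1) : \chi\in\operatorname{Irr}(G)\}$ denotes the set of irreducible character degrees. The prime character degree graph $\Delta(G)$ is the simple graph whose vertices are the prime numbers $p$ such that $p$ divides some $a\in\operatorname{cd}(G)$, with two distinct vertices $p$ and $q$ joined by an edge if and only if $pq$ divides some $b\in\operatorname{cd}(G)$. *)

(* Defs.v *)
From HB Require Import structures.
From mathcomp Require Import all_boot all_order all_algebra all_fingroup.
From mathcomp Require Import all_solvable all_field all_character.

Set Implicit Arguments.
Unset Strict Implicit.
Unset Printing Implicit Defensive.

(* Characters take values in algC; every complex character of a finite group
   is realized over the algebraic numbers, so Irr(G) is unchanged. *)
Definition cd (gT : finGroupType) (G : {group gT}) : {pred nat} :=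
  [pred a : nat | [exists i : Iirr G, ('chi[G]_i 1%g == a%:R)%R]].

Definition Delta_vertex (gT : finGroupType) (G : {group gT}) (x : nat) : Prop :=
  prime x /\ exists2 a, a \in cd G & x %| a.

Definition Delta_adj (gT : finGroupType) (G : {group gT}) (x y : nat) : Prop :=
  [/\ Delta_vertex G x, Delta_vertex G y, x <> y
    & exists2 b, b \in cd G & x * y %| b].

(* Main.v *)
Require Import Defs.
From mathcomp Require Import all_boot all_order all_algebra all_fingroup.
From mathcomp Require Import all_solvable all_field all_character.
From mathcomp Require Import ring.

Set Implicit Arguments.
Unset Strict Implicit.
Unset Printing Implicit Defensive.

Import GroupScope Order.TTheory GRing.Theory Num.Theory.
Local Open Scope ring_scope.

(** Write N for the product of the p_i, q = 2^N, and F for the field with q^2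
elements.  The group is G = P : (C : K), where P is the Sylow 2-subgroup of
SU(3, q), that is, the pairs (a, b) in F x F with b^q + b = a^(q+1); C = F^*
acts by (a, b) -> (c a, c^(q+1) b), and K, of order N, is generated by the
fourth-power automorphism of F; the square of the Frobenius automorphism is taken
so that C : K has odd order.  The centre Z of P is the set of the pairs
(0, b), of order q.

Since P has order prime to C : K, every character theta of P extends to its
inertia group, and the degrees of G above theta are the products
|C K : I| theta(1) beta(1), where I is the inertia group of theta in C K and
beta is an irreducible character of I (cd_coprime_sdprod).  There are three kinds
of theta.
- The principal character, with I = C K: the degrees are those of C K, which
  divide N because C is an abelian normal subgroup of coprime index N.
- The q^2 - 1 other characters of P / Z.  They are linear and C permutes them
  regularly, so I is isomorphic to K, which is abelian: the only degree is q^2 - 1.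
- The characters that are nontrivial on Z.  They vanish off Z, so they have
  degree q, and there are q - 1 of them.  The stabilizer in C of each of them is
  the subgroup D of order q + 1, so C permutes them transitively and I is an
  extension of D by a group of order N: the degrees are q (q - 1) b with b
  dividing N.  The value b = N occurs, because D is its own centralizer in I.
Thus every degree divides q (q - 1) N or is equal to q^2 - 1, and both these
numbers are degrees (exists_solvable_cd_pow2).  Their sets of prime divisors are
the two cliques of the graph, since q - 1 is the product of the q_j and q + 1 is
three times the product of the r_l. *)

(** * Degrees above a normal Hall subgroup *)

Lemma cdP (gT : finGroupType) (G : {group gT}) a :
  reflect (exists i : Iirr G, 'chi_i 1%g = a%:R)%R (a \in cd G).
Proof. exact: exists_eqP. Qed.

Lemma cd_isog (aT rT : finGroupType) (G : {group aT}) (R : {group rT}) a :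
  G \isog R -> a \in cd G -> a \in cd R.
Proof.
case/isogP=> f injf im_f /cdP[i chi1]; apply/cdP.
have isoGR : isom G R f by apply/isomP.
by exists (isom_Iirr isoGR i); rewrite isom_IirrE cfIsom1.
Qed.

Lemma cd_abelian (gT : finGroupType) (G : {group gT}) a :
  abelian G -> a \in cd G -> a = 1%N.
Proof.
move=> abG /cdP[i chi1]; apply/eqP; rewrite -(eqr_nat algC) -chi1.
by rewrite lin_char1 //; apply/char_abelianP.
Qed.

Lemma cd1 (gT : finGroupType) (G : {group gT}) : 1%N \in cd G.
Proof. by apply/cdP; exists 0%R; rewrite irr0 cfun11. Qed.

Lemma index_inertia_sdprod (gT : finGroupType) (G N H : {group gT}) (i : Iirr N) :
  N ><| H = G -> #|G : 'I_G['chi_i]| = #|H : 'I_H['chi_i]|.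
Proof.
move=> defG; have sdT := sdprod_modl defG (sub_inertia 'chi_i).
apply/eqP; rewrite -(eqn_pmul2l (cardG_gt0 'I_G['chi_i])) Lagrange ?subsetIl //.
by rewrite -(sdprod_card sdT) -mulnA Lagrange ?subsetIl ?(sdprod_card defG).
Qed.

(** The order and the degree of a character theta of N divide powers of |N|, so
they are prime to |H| and theta extends to its inertia group T.  By Gallagher's
theorem the characters of T above theta are the products of one extension with
the characters of T / N, which is isomorphic to the inertia group in H; by the
Clifford correspondence these characters induce irreducibly to G. *)
Lemma cd_coprime_sdprod (gT : finGroupType) (G N H : {group gT}) a :
    N ><| H = G -> coprime #|N| #|H| -> solvable H ->
  a \in cd G <-> exists i : Iirr N, exists2 b,
    b \in cd 'I_H['chi_i] & ((#|H : 'I_H['chi_i]| * b)%N%:R * 'chi_i 1%g = a%:R)%R.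
Proof.
move=> defG coNH solH; have [nsNG sHG _ _ _] := sdprod_context defG.
(* Gallagher's parametrization of the characters of T above theta by T / N. *)
have key i : exists2 ext : Iirr ('I_G['chi[N]_i] / N) -> Iirr 'I_G['chi_i],
    {in irr_constt ('Ind['I_G['chi_i]] 'chi_i), forall t, exists b, t = ext b}
  & forall b, ext b \in irr_constt ('Ind['I_G['chi_i]] 'chi_i)
    /\ ('chi_(ext b) 1%g = 'chi_b 1%g * 'chi_i 1%g)%R.
  pose T := 'I_G['chi_i]%G.
  have nsNT : N <| T by apply: normal_Inertia (normal_sub nsNG).
  have iTN : (#|T : N| %| #|H|)%N.
    have -> : #|H| = #|G : N| by rewrite (index_sdprod defG).
    by rewrite indexSg ?subsetIl ?normal_sub.
  have solT : solvable (T / N).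
    have := isog_sol (sdprod_isog defG); rewrite solH => /esym solGN.
    by rewrite (solvableS _ solGN) ?quotientS ?subsetIl.
  have coT : coprime #|T : N| ('o('chi_i)%CF * Num.truncn ('chi_i 1%g))%N.
    rewrite (coprime_dvdl iTN) // coprime_sym coprimeMl.
    rewrite (coprime_dvdl (cfDet_order_dvdG _)) //=.
    rewrite (coprime_dvdl _ coNH) //.
    have := dvd_irr1_cardG i; rewrite irr1_degree natrK.
    by rewrite dvdC_nat.
  have [c [cN _ _]] := extend_solvable_coprime_irr nsNT solT (subsetIr _ _) coT.
  have [irrM _ ext_i _] := constt_Ind_ext nsNT cN.
  exists (mul_mod_Iirr c) => [t | b].
    by rewrite ext_i => /codomP.
  rewrite ext_i codom_f; split=> //.
  rewrite /mul_mod_Iirr /mul_Iirr cfIirrE ?irrM // cfunE.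
  rewrite mod_IirrE // cfMod1; congr (_ * _).
  by rewrite -[RHS](congr1 (fun phi : 'CF(N) => phi 1%g) cN) cfRes1.
have sdT i : N ><| 'I_H['chi[N]_i] = 'I_G['chi_i].
  by apply: sdprod_modl defG (sub_inertia _).
have isoT i := sdprod_isog (sdT i).
split=> [/cdP[s chi1] | [i [b /(cd_isog (isoT i))/cdP[b' b'1] Da]]].
  have [i Ni] := constt_cfRes_irr N s; exists i.
  have [ext extP ext1] := key i.
  have [indirr _ AB _ _] := constt_Inertia_bijection i nsNG.
  move: Ni; rewrite -constt_Ind_Res -AB => /imsetP[t At Ds].
  have [b Dt] := extP t At; have [Ab b1] := ext1 b.
  have /natrP[d b_d] := Cnat_irr1 b.
  have b_cd : d \in cd ('I_G['chi_i] / N) by apply/cdP; exists b.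
  exists d.
    have isoT' := isoT i; rewrite isog_sym in isoT'.
    exact: (cd_isog isoT' b_cd).
  rewrite -chi1 Ds cfIirrE ?indirr // cfInd1 ?subsetIl // (index_inertia_sdprod i defG) Dt b1.
  by rewrite b_d natrM mulrA.
have [ext extP ext1] := key i; have [Ab b1] := ext1 b'.
have [indirr _ _ _ _] := constt_Inertia_bijection i nsNG.
apply/cdP; exists (Ind_Iirr G (ext b')).
rewrite cfIirrE ?indirr // cfInd1 ?subsetIl // (index_inertia_sdprod i defG) b1 b'1 -Da.
by rewrite natrM mulrA.
Qed.

(** The coprime case of a theorem of Ito: the degree of a character above a linear
character of A is the size of its orbit under an abelian complement. *)
Lemma cd_dvd_index_abelian (gT : finGroupType) (G A : {group gT}) a :
    A <| G -> abelian A -> abelian (G / A) -> coprime #|A| #|G : A| ->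
  a \in cd G -> (a %| #|G : A|)%N.
Proof.
move=> nsAG abA abGA coA.
have /splitsP[H] : [splits G, over A].
  by apply: SchurZassenhaus_split; rewrite // /Hall normal_sub.
rewrite complgC => /(sdprod_normal_complP nsAG) defG.
have abH : abelian H by rewrite (isog_abelian (sdprod_isog defG)).
rewrite -(index_sdprod defG) in coA *.
case/(cd_coprime_sdprod a defG coA (abelian_sol abH)) => i [b].
move/(cd_abelian (abelianS (subsetIl _ _) abH)) => ->.
rewrite lin_char1; last by apply/char_abelianP.
rewrite mulr1 muln1 => /eqP; rewrite eqr_nat => /eqP <-.
exact: dvdn_indexg.
Qed.

(** The value at a generator determines a linear character, and there are as many
linear characters as roots of unity of order dividing |A|; hence some character
maps the generator to a primitive root. *)
Lemma cyclic_faithful_lin_char (gT : finGroupType) (A : {group gT}) :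
  cyclic A -> exists i : Iirr A, {in A &, injective 'chi_i}.
Proof.
case/cyclicP=> x defA.
have Ax : x \in A by rewrite defA cycle_id.
have memA y : y \in A -> exists k, y = (x ^+ k)%g.
  by rewrite defA => /cycleP.
have linA (i : Iirr A) : 'chi_i \is a linear_char.
  by apply/char_abelianP; rewrite defA cycle_abelian.
have [w prim_w] := C_prim_root_exists (order_gt0 x).
have val i := prim_rootP prim_w (lin_char_unity_root (linA i) Ax).
have val_inj : injective (fun i => sval (val i)).
  move=> i j eq_ij; apply: irr_inj; apply/cfun_inP=> y.
  move=> /memA[k ->]; rewrite !lin_charX //.
  by rewrite (svalP (val i)) (svalP (val j)) eq_ij.
have wP : (w ^+ 1) ^+ #[x] = 1 by rewrite expr1 prim_expr_order.
have [k Dk] := prim_rootP prim_w wP.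
have /codomP[i Di] : k \in codom (fun i => sval (val i)).
  apply: (inj_card_onto val_inj).
  by rewrite card_ord card_Iirr_abelian defA ?cycle_abelian.
exists i; apply: fful_lin_char_inj => //; apply/subsetP=> y.
rewrite cfkerEirr inE lin_char1 // => chiy.
have : y \in A by apply: (subsetP (cfker_sub 'chi_i)); rewrite cfkerEirr inE lin_char1.
move: chiy => /eqP + /memA[m Dy].
rewrite Dy lin_charX // (svalP (val i)) -Di -Dk expr1 => /eqP.
by rewrite -(prim_order_dvd prim_w) order_dvdn => /eqP->; rewrite inE.
Qed.

(** An element that fixes a faithful linear character of A centralizes A, so the
orbit of such a character under a complement is regular. *)
Lemma index_in_cd (gT : finGroupType) (G A : {group gT}) :
    A <| G -> cyclic A -> abelian (G / A) -> coprime #|A| #|G : A| ->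
  'C_G(A) \subset A -> #|G : A| \in cd G.
Proof.
move=> nsAG cycA abGA coA sCA.
have /splitsP[H] : [splits G, over A].
  by apply: SchurZassenhaus_split; rewrite // /Hall normal_sub.
rewrite complgC => /(sdprod_normal_complP nsAG) defG.
have abH : abelian H by rewrite (isog_abelian (sdprod_isog defG)).
have [_ sHG _ nAH tiAH] := sdprod_context defG.
rewrite -(index_sdprod defG) in coA *.
have [i inj_i] := cyclic_faithful_lin_char cycA.
apply/(cd_coprime_sdprod _ defG coA (abelian_sol abH)); exists i, 1%N.
  exact: cd1.
rewrite lin_char1; last by apply/char_abelianP/cyclic_abelian.
rewrite (_ : 'I_H['chi_i] = 1%g) ?indexg1 ?muln1 ?mulr1 //.
apply/trivgP; rewrite -tiAH [A :&: H]setIC subsetI subsetIl /=.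
apply: subset_trans sCA; apply/subsetP=> h /setIP[Hh Ih].
rewrite inE (subsetP sHG) //=; apply/centP=> x Ax; apply/commute_sym/commgP/conjg_fixP.
apply: inj_i; rewrite ?memJ_norm ?(subsetP nAH) //.
exact: inertia_valJ.
Qed.

(** * Characters of a group of class two with large commutator sets *)

Section CaminaPair.

Variables (gT : finGroupType) (P Z : {group gT}).
Hypotheses (sZP : Z \subset 'Z(P)) (sP'Z : P^`(1)%g \subset Z).
Hypothesis camina :
  forall x z, x \in P -> x \notin Z -> z \in Z -> exists2 y, y \in P & [~ x, y] = z.

Let nsZP : Z <| P.
Proof. exact: sub_center_normal. Qed.

Definition Iirr_over_quo := [set i : Iirr P | Z \subset cfker 'chi_i].

Lemma Iirr_over_quo_lin i : i \in Iirr_over_quo -> 'chi_i \is a linear_char.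
Proof. by rewrite inE lin_irr_der1; apply: subset_trans. Qed.

Lemma card_Iirr_over_quo : #|Iirr_over_quo| = #|P : Z|.
Proof.
have -> : Iirr_over_quo = [set mod_Iirr j | j : Iirr (P / Z)].
  apply/setP=> i; rewrite inE; apply/idP/imsetP=> [Zi | [j _ ->]].
    by exists (quo_Iirr Z i); rewrite ?quo_IirrK.
  by rewrite mod_IirrE ?cfker_mod.
rewrite card_imset; last exact: can_inj (mod_IirrK nsZP).
by rewrite card_Iirr_abelian ?sub_der1_abelian // card_quotient ?normal_norm.
Qed.

(** The class of x contains the coset x Z, so |C_P(x)| <= |P : Z|.  The |P : Z|
linear characters over P / Z already contribute |P : Z| to the sum of the
|chi(x)|^2, which is equal to |C_P(x)|: all the other terms are zero. *)
Lemma camina_irr_vanish i x :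
  i \notin Iirr_over_quo -> x \in P -> x \notin Z -> 'chi_i x = 0.
Proof.
move=> notSi Px notZx.
have cent_x : (#|'C_P[x]| <= #|P : Z|)%N.
  rewrite -(leq_pmul2l (cardG_gt0 Z)) Lagrange ?normal_sub //.
  rewrite -(Lagrange (subsetIl P 'C[x])) mulnC leq_mul2l index_cent1.
  apply/orP; right.
  rewrite -(card_imset _ (mulgI x)) subset_leq_card //.
  apply/subsetP=> _ /imsetP[z Zz ->].
  by have [y Py <-] := camina Px notZx Zz; rewrite -conjg_mulR memJ_class.
have := second_orthogonality_relation x Px.
rewrite class_refl mulr1n => sum_x.
have : (\sum_(j in ~: Iirr_over_quo) 'chi_j x * ('chi_j x)^* <= 0)%R.
  rewrite -(@lerD2l algC (\sum_(j in Iirr_over_quo) 'chi_j x * ('chi_j x)^*)) addr0.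
  have -> : \sum_(j in Iirr_over_quo) 'chi_j x * ('chi_j x)^* = #|P : Z|%:R.
    rewrite -card_Iirr_over_quo -sumr_const; apply: eq_bigr => j Sj.
    by rewrite -normCK normC_lin_char ?expr1n ?Iirr_over_quo_lin.
  rewrite (_ : _ + _ = #|'C_P[x]|%:R) ?ler_nat //.
  rewrite -sum_x [RHS](bigID (mem Iirr_over_quo)) /=; congr (_ + _).
    rewrite -card_Iirr_over_quo -sumr_const; apply: eq_bigr => j Sj.
    by rewrite -normCK normC_lin_char ?expr1n ?Iirr_over_quo_lin.
  by apply: eq_bigl => j; rewrite inE.
have sq_ge0 j : 0 <= 'chi[P]_j x * ('chi_j x)^* by rewrite mul_conjC_ge0.
rewrite le_eqVlt le_gtF ?sumr_ge0 // orbF psumr_eq0 // => /allP/(_ i).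
by rewrite mem_index_enum inE notSi mul_conjC_eq0 => /(_ isT)/eqP.
Qed.

(** Vanishing off Z forces the centre of the character to be Z; as P / Z is
abelian, the degree is then as large as this centre allows. *)
Lemma camina_irr1 i : i \notin Iirr_over_quo -> 'chi_i 1%g ^+ 2 = #|P : Z|%:R.
Proof.
move=> notSi; have Z_i : 'Z('chi_i)%CF = Z.
  apply/eqP; rewrite eqEsubset; apply/andP; split; last first.
    apply: subset_trans sZP _; rewrite -(cap_cfcenter_irr P); exact: bigcap_inf.
  apply/subsetP=> x Zx; have Px := subsetP (cfcenter_sub _) x Zx.
  apply: contraLR Zx => notZx; rewrite irr_cfcenterE //.
  by rewrite camina_irr_vanish // normr0 eq_sym irr1_neq0.
rewrite -[in RHS]Z_i; apply: irr1_abelian_bound.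
by rewrite Z_i sub_der1_abelian.
Qed.

Variable q : nat.
Hypotheses (cardZ : #|Z| = q) (cardPZ : #|P : Z| = (q ^ 2)%N).

Lemma camina_irr1_sqrt i : i \notin Iirr_over_quo -> 'chi_i 1%g = q%:R.
Proof.
move=> /camina_irr1/eqP; rewrite irr1_degree cardPZ -natrX eqr_nat.
by rewrite eqn_exp2r // => /eqP->.
Qed.

(** The squares of the degrees add up to q^3; the linear characters over P / Z
account for q^2 and each other character for q^2. *)
Lemma card_Iirr_camina : #|~: Iirr_over_quo| = q.-1.
Proof.
have q_gt0 : (0 < q)%N by rewrite -cardZ.
have := irr_sum_square P; rewrite (bigID (mem Iirr_over_quo)) /=.
rewrite (eq_bigr (fun=> 1)) => [|i /Iirr_over_quo_lin/lin_char1->]; last first.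
  by rewrite expr1n.
rewrite [X in _ + X](eq_bigr (fun=> (q ^ 2)%N%:R)) => [|i]; last first.
  by move=> /camina_irr1_sqrt->; rewrite natrX.
rewrite !sumr_const card_Iirr_over_quo -(Lagrange (normal_sub nsZP)) cardZ cardPZ.
rewrite -mulrnA -natrD => /eqP; rewrite eqr_nat.
rewrite (eq_card (_ : _ =i ~: Iirr_over_quo)) => [/eqP eq_q | i]; last by rewrite in_setC.
apply/eqP; rewrite -eqSS prednK //.
rewrite -(@eqn_pmul2l (q ^ 2)) ?expn_gt0 ?q_gt0 //.
by rewrite mulnS eq_q mulnC.
Qed.

End CaminaPair.

(** * Orbits of characters *)

Section Orbit.

Variables (gT : finGroupType) (P G H C : {group gT}).
Hypotheses (defG : P ><| H = G) (sCH : C \subset H).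

(** The C-orbit of chi_i has as many elements as S, and the H-orbit, which contains
it, stays inside S; so the H-orbit is all of S. *)
Lemma index_inertia_orbit (S : {set Iirr P}) i :
    {in S & H, forall j h, conjg_Iirr j h \in S} -> i \in S ->
  #|S| = #|C : 'I_C['chi_i]| -> #|H : 'I_H['chi_i]| = #|S|.
Proof.
move=> H_S Si cardS; have [nsPG sHG _ _ _] := sdprod_context defG.
apply/eqP; rewrite eqn_leq; apply/andP; split.
  rewrite -(index_inertia_sdprod i defG).
  rewrite -card_cfclass_Iirr // subset_leq_card //; apply/subsetP=> j.
  rewrite cfclass_IirrE => /cfclassP[g Gg Dj].
  have [x [h [Px Hh Dg _]]] := mem_sdprod defG Gg.
  have nP y : y \in G -> y \in 'N(P) by apply: (subsetP (normal_norm nsPG)).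
  suff -> : j = conjg_Iirr i h by apply: H_S.
  have [nPx nPh] := (nP x (subsetP (normal_sub nsPG) x Px), nP h (subsetP sHG h Hh)).
  by apply: irr_inj; rewrite conjg_IirrE Dj Dg cfConjgMnorm // (cfConjg_id _ Px).
rewrite cardS -(leq_pmul2l (cardG_gt0 'I_C['chi_i])) Lagrange ?subsetIl //.
rewrite -(leq_pmul2l (cardG_gt0 'I_H['chi_i])) mulnCA Lagrange ?subsetIl //.
rewrite mulnC mul_cardG mulnC leq_mul //; last first.
  by rewrite subset_leq_card ?mul_subG ?subsetIl.
by rewrite subset_leq_card //; apply/subsetP=> x; rewrite !inE => /andP[-> /andP[_ ->]].
Qed.

End Orbit.

(** * Degrees of the semidirect product *)

Section Degrees.

Variables (gT : finGroupType) (P Z C D K H G : {group gT}) (q : nat).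
Hypotheses (defG : P ><| H = G) (defH : C ><| K = H).
Hypotheses (sZP : Z \subset 'Z(P)) (sP'Z : P^`(1)%g \subset Z).
Hypotheses (nZH : H \subset 'N(Z)) (cycC : cyclic C) (abK : abelian K).
Hypotheses (sDC : D \subset C) (cDZ : D \subset 'C(Z)) (sCD : 'C_H(D) \subset C).
Hypotheses (coPH : coprime #|P| #|H|) (coCK : coprime #|C| #|K|).
Hypotheses (q_gt1 : (1 < q)%N) (cardZ : #|Z| = q) (cardPZ : #|P : Z| = (q ^ 2)%N).
Hypotheses (cardC : #|C| = (q ^ 2).-1) (cardD : #|D| = q.+1).
Hypothesis camina :
  forall x z, x \in P -> x \notin Z -> z \in Z -> exists2 y, y \in P & [~ x, y] = z.
(** For c, surjectivity of y -> [y, c] amounts to fixed-point-freeness on P / Z or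
on Z.  Surjectivity is the form that meets characters directly: a linear character
fixed by c is trivial on every [y, c]. *)
Hypothesis C_moves_P : forall c x, c \in C -> c != 1%g -> x \in P ->
  exists2 y, y \in P & (x * [~ y, c]^-1)%g \in Z.
Hypothesis C_moves_Z : forall c z, c \in C -> c \notin D -> z \in Z ->
  exists2 y, y \in Z & [~ y, c] = z.

Let sqr_pred : (q ^ 2).-1 = (q.+1 * q.-1)%N.
Proof. by rewrite -(subn1 (q ^ 2)) -[X in (_ - X)%N](exp1n 2) subn_sqr addn1 subn1 mulnC. Qed.

Local Notation S := (Iirr_over_quo P Z).

Let nPH : H \subset 'N(P). Proof. by case/sdprod_context: defG. Qed.
Let nsCH : C <| H. Proof. by case/sdprod_context: defH. Qed.
Let sCH : C \subset H := normal_sub nsCH.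

Let abHC : abelian (H / C).
Proof. by rewrite -(isog_abelian (sdprod_isog defH)). Qed.

Let sH'C : H^`(1)%g \subset C.
Proof. exact: der1_min (normal_norm nsCH) abHC. Qed.

Let solH : solvable H.
Proof.
rewrite (series_sol nsCH) abelian_sol ?cyclic_abelian //=.
exact: abelian_sol.
Qed.

Let S_stable j h : h \in H -> (conjg_Iirr j h \in S) = (j \in S).
Proof.
move=> Hh; rewrite !inE conjg_IirrE cfker_conjg ?(subsetP nPH) //.
by rewrite -{1}(normsP nZH h Hh) conjSg.
Qed.

(** A linear character fixed by c is trivial on all [y, c], and with Z these
commutators cover P when c is not trivial. *)
Lemma inertia_over_quo i :
  i \in S -> i != 0 -> C :&: 'I['chi_i] = 1%g.
Proof.
move=> Si nzi; apply/trivgP/subsetP=> c /setIP[Cc Ic]; rewrite inE.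
apply: contraR nzi => ntc; rewrite -subGcfker; apply/subsetP=> x Px.
have lin_i := Iirr_over_quo_lin sP'Z Si.
have [y Py Zxy] := C_moves_P Cc ntc Px.
have ker_yc : [~ y, c] \in cfker 'chi_i.
  have Pyc : (y ^ c)%g \in P by rewrite memJ_norm // (subsetP nPH) ?(subsetP sCH).
  rewrite cfkerEirr inE lin_char1 // commgEl lin_charM ?groupV // lin_charV //.
  by rewrite inertia_valJ // mulVf // lin_char_neq0.
rewrite inE in Si.
by rewrite -(mulgKV [~ y, c] x) groupM // (subsetP Si).
Qed.

(** The restriction of chi_i to the central subgroup Z is a multiple of a linear
character, so an element c outside D that fixes chi_i puts [Z, c] = Z into the
kernel.  Conversely, chi_i vanishes off Z, which D centralizes. *)
Lemma inertia_camina i : i \notin S -> C :&: 'I['chi_i] = D.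
Proof.
move=> notSi; apply/eqP; rewrite eqEsubset; apply/andP; split.
  apply/subsetP=> c /setIP[Cc Ic]; apply: contraR notSi => notDc.
  rewrite inE; apply/subsetP=> z Zz.
  have [y Zy <-] := C_moves_Z Cc notDc Zz.
  have [xi lin_xi Dxi] := cfcenter_Res 'chi_i.
  have sZZi : Z \subset 'Z('chi_i)%CF.
    by apply: subset_trans sZP _; rewrite -(cap_cfcenter_irr P) bigcap_inf.
  have Zyc : (y ^ c)%g \in Z by rewrite memJ_norm // (subsetP nZH) ?(subsetP sCH).
  have val x : x \in Z -> 'chi_i x = 'chi_i 1%g * xi x.
    move=> Zx; have Zix := subsetP sZZi x Zx.
    by rewrite -[LHS](cfResE _ (cfcenter_sub 'chi_i) Zix) Dxi cfunE.
  rewrite cfkerEirr inE commgEl val; last exact: groupM (groupVr Zy) Zyc.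
  have [Ziy Ziyc] := (subsetP sZZi _ Zy, subsetP sZZi _ Zyc).
  rewrite (lin_charM lin_xi (groupVr Ziy) Ziyc) (lin_charV lin_xi Ziy).
  rewrite (_ : xi (y ^ c)%g = xi y); last first.
    by apply: (mulfI (irr1_neq0 i)); rewrite -!val // inertia_valJ.
  by rewrite mulVf ?mulr1 // (lin_char_neq0 lin_xi Ziy).
apply/subsetP=> d Dd; have Cd := subsetP sDC d Dd.
have nPd : d \in 'N(P) by rewrite (subsetP nPH) ?(subsetP sCH).
rewrite inE Cd inE nPd /=; apply/eqP/cfun_inP=> x Px.
rewrite cfConjgE //; have [Zx | notZx] := boolP (x \in Z).
  rewrite (conjg_fixP _) //; apply/commgP/commuteV.
  exact: commute_sym (centP (subsetP cDZ d Dd) x Zx).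
rewrite !(camina_irr_vanish sZP sP'Z camina) //; first by rewrite memJ_norm ?groupV.
by rewrite memJ_norm // groupV (subsetP nZH) ?(subsetP sCH).
Qed.

Lemma index_inertia_over_quo i :
  i \in S -> i != 0 -> #|H : 'I_H['chi_i]| = (q ^ 2).-1.
Proof.
move=> Si nzi.
have cardS0 : #|S :\ (0 : Iirr P)| = (q ^ 2).-1.
  have := cardsD1 (0 : Iirr P) S; rewrite (card_Iirr_over_quo sZP sP'Z) cardPZ.
  by rewrite inE cfker_irr0 (subset_trans sZP) ?center_sub // => ->.
rewrite (index_inertia_orbit defG sCH (S := S :\ (0 : Iirr P))) //.
- by move=> j h Sj Hh; move: Sj; rewrite !in_setD1 S_stable // conjg_Iirr_eq0.
- by rewrite in_setD1 nzi.
by rewrite inertia_over_quo // indexg1 cardC.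
Qed.

Lemma index_inertia_camina i : i \notin S -> #|H : 'I_H['chi_i]| = q.-1.
Proof.
move=> notSi; have cardSc := card_Iirr_camina sZP sP'Z camina cardZ cardPZ.
rewrite (index_inertia_orbit defG sCH (S := ~: S)) ?in_setC //.
  by move=> j h; rewrite !in_setC => Sj Hh; rewrite S_stable.
rewrite inertia_camina // cardSc; apply/eqP.
rewrite -(eqn_pmul2l (cardG_gt0 D)) Lagrange // cardC cardD.
by rewrite sqr_pred.
Qed.

Let abI i (A := C :&: 'I['chi[P]_i]) : abelian ('I_H['chi_i] / A).
Proof.
apply: sub_der1_abelian; rewrite subsetI (subset_trans (dergS 1 (subsetIl _ _))) //.
by rewrite (subset_trans (der_sub 1 _)) ?subsetIr.
Qed.

Lemma inertia_camina_context i (I := 'I_H['chi[P]_i]%G) : i \notin S ->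
  [/\ D <| I, abelian (I / D), coprime #|D| #|I : D| & #|I : D| = #|K|].
Proof.
move=> notSi; have sDI : D \subset I.
  by rewrite -(inertia_camina notSi) setSI.
have nsDI : D <| I.
  apply: normalS sDI (subsetIl _ _) _.
  by apply: char_normal_trans nsCH; rewrite sub_cyclic_char.
have cardI : #|I : D| = #|K|.
  apply/eqP; rewrite -(eqn_pmul2l (cardG_gt0 D)) Lagrange //.
  have q1_gt0 : (0 < q.-1)%N by rewrite -subn1 subn_gt0.
  rewrite -(eqn_pmul2r q1_gt0) -[in X in X == _](index_inertia_camina notSi).
  rewrite Lagrange ?subsetIl // -(sdprod_card defH) cardC cardD.
  by rewrite sqr_pred mulnAC.
split=> //; first by rewrite -(inertia_camina notSi); apply: abI.
by rewrite cardI (coprime_dvdl (cardSg sDC)).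
Qed.

Lemma cd_semidirect_cases a :
  a \in cd G -> (a %| q * q.-1 * #|K|)%N \/ a = (q ^ 2).-1.
Proof.
case/(cd_coprime_sdprod a defG coPH solH) => i [b b_cd].
have [Di | nzi] := eqVneq i 0.
  have I_H : 'I_H['chi_i] = H by rewrite Di irr0 inertia1; apply/setIidPl.
  have {}b_cd : b \in cd H.
    by rewrite (_ : H = 'I_H['chi_i]%G) //; apply: val_inj; rewrite /= I_H.
  rewrite I_H indexgg mul1n Di irr0 cfun11 mulr1 => /eqP.
  rewrite eqr_nat => /eqP <-; left; apply: dvdn_mull.
  rewrite (index_sdprod defH); apply: cd_dvd_index_abelian b_cd => //.
    exact: cyclic_abelian.
  by rewrite -(index_sdprod defH).
have [Si | notSi] := boolP (i \in S).
  rewrite (index_inertia_over_quo Si nzi) lin_char1 ?(Iirr_over_quo_lin sP'Z) //.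
  have abI1 : abelian 'I_H['chi_i].
    apply/derG1P/trivgP; rewrite -(inertia_over_quo Si nzi) subsetI.
    rewrite (subset_trans (dergS 1 (subsetIl _ _)) sH'C).
    by rewrite (subset_trans (der_sub 1 _)) ?subsetIr.
  rewrite (cd_abelian abI1 b_cd) muln1 mulr1 => /eqP.
  by rewrite eqr_nat => /eqP <-; right.
rewrite (camina_irr1_sqrt sZP sP'Z camina cardPZ) // index_inertia_camina //.
rewrite -natrM => /eqP; rewrite eqr_nat => /eqP <-; left.
have [nsDI abID coDI iID] := inertia_camina_context notSi.
rewrite mulnC mulnA dvdn_mul // -iID; apply: cd_dvd_index_abelian b_cd => //.
exact: abelianS sDC (cyclic_abelian cycC).
Qed.

(** The inertia group I of a character nontrivial on Z contains D as a
self-centralizing cyclic normal subgroup of coprime index |K|, so |K| is a degree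
of I. *)
Lemma cd_semidirect_top : (q * q.-1 * #|K|)%N \in cd G.
Proof.
have /subsetPn[i _ notSi] : ~~ ([set: Iirr P] \subset S).
  rewrite -setCS setCT subset0 -card_gt0.
  by rewrite (card_Iirr_camina sZP sP'Z camina cardZ cardPZ) -subn1 subn_gt0.
have [nsDI abID coDI iID] := inertia_camina_context notSi.
apply/(cd_coprime_sdprod _ defG coPH solH); exists i, #|K|.
  rewrite -iID; apply: index_in_cd => //; first exact: cyclicS sDC cycC.
  apply: subset_trans (_ : C :&: 'I['chi_i] \subset D); last first.
    by rewrite inertia_camina.
  rewrite subsetI.
  rewrite (subset_trans _ sCD) ?setSI ?subsetIl //=.
  by rewrite setIAC subsetIr.
rewrite (camina_irr1_sqrt sZP sP'Z camina cardPZ) // index_inertia_camina //.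
by rewrite -natrM mulnC mulnA.
Qed.

Lemma cd_semidirect_quo : (q ^ 2).-1 \in cd G.
Proof.
have /subsetPn[i Si nzi] : ~~ (S \subset [set (0 : Iirr P)]).
  apply/negP=> /subset_leq_card; rewrite cards1 (card_Iirr_over_quo sZP sP'Z).
  by rewrite cardPZ leqNgt -(exp1n 2) ltn_exp2r ?q_gt1.
apply/(cd_coprime_sdprod _ defG coPH solH); exists i, 1%N; first exact: cd1.
rewrite inE in nzi; rewrite index_inertia_over_quo // muln1.
by rewrite lin_char1 ?mulr1 ?(Iirr_over_quo_lin sP'Z).
Qed.

End Degrees.

(** * Powers of 4 modulo 2^N + 1 *)

(** Modulo 2^N + 1, the powers of 4 depend only on the residue r of the exponent
modulo N.  If 2r <= N, then 4^r is at most 2^N, so it is 1 only for r = 0; if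
2r = N + s with s > 0, then 4^r is congruent to - 2^s, with 2^s + 1 < 2^N + 1. *)
Lemma dvdn_pow4_eq1 N k : (0 < N)%N ->
  4 ^ k = 1 %[mod (2 ^ N).+1] -> (N %| k)%N.
Proof.
move=> N_gt0 eq1; rewrite /dvdn; set r := (k %% N)%N.
have r_lt : (r < N)%N by rewrite ltn_mod.
have q_gt1 : (1 < 2 ^ N)%N by rewrite -(expn0 2) ltn_exp2l.
have q2 : (4 ^ N = 1 %[mod (2 ^ N).+1])%N.
  apply/eqP; rewrite -[4%N]/(2 ^ 2)%N -expnM mulnC expnM eqn_mod_dvd ?expn_gt0 //.
  by rewrite -[X in (_ - X)%N](exp1n 2) subn_sqr addn1 dvdn_mull.
have {eq1}: (4 ^ r = 1 %[mod (2 ^ N).+1])%N.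
  rewrite -eq1 [in RHS](divn_eq k N) expnD [(k %/ N * N)%N]mulnC expnM -/r.
  by rewrite -[RHS]modnMml -(modnXm (k %/ N)) q2 modnXm exp1n modnMml mul1n.
rewrite -[4%N]/(2 ^ 2)%N -expnM; have [le_r | lt_r] := leqP (2 * r) N.
  have le_q : (2 ^ (2 * r) <= 2 ^ N)%N by rewrite leq_exp2l.
  rewrite !modn_small ?ltnS //; last exact: ltnW.
  by move/eqP; rewrite -[X in _ == X](expn0 2) eqn_exp2l // muln_eq0.
pose s := (2 * r - N)%N; have Ds : (2 * r = N + s)%N by rewrite subnKC // ltnW.
have s_lt : (s < N)%N.
  by rewrite -(ltn_add2l N) -Ds addnn -mul2n ltn_pmul2l.
move/eqP; rewrite eqn_mod_dvd ?expn_gt0 // => dv.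
have dv_sum : ((2 ^ N).+1 %| (2 ^ (2 * r) - 1) + (2 ^ s).+1)%N.
  rewrite addnS -addSn -subSn ?expn_gt0 // subn1 /= Ds expnD -[X in (_ + X)%N]mul1n.
  by rewrite -mulnDl addn1 dvdn_mulr.
rewrite dvdn_addr // in dv_sum.
by have := dvdn_leq (ltn0Sn _) dv_sum; rewrite ltnS leq_exp2l // leqNgt s_lt.
Qed.

(** * The field with 4^N elements *)

Section Model.

Variables (F : finFieldType) (N : nat).
Hypotheses (N_gt0 : (0 < N)%N) (char2 : 2%N \in [pchar F]).
Let q := (2 ^ N)%N.
Hypothesis cardF : #|F| = (q ^ 2)%N.

Let q_gt1 : (1 < q)%N. Proof. by rewrite -(expn0 2) ltn_exp2l. Qed.
Let q_gt0 : (0 < q)%N. Proof. exact: ltnW. Qed.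

Let exprDq (x y : F) : (x + y) ^+ q = x ^+ q + y ^+ q.
Proof.
by apply: exprDn_pchar; rewrite pnatX (eq_pnat _ (pcharf_eq char2)) pnat_id.
Qed.

Let exprD4 k (x y : F) : (x + y) ^+ (4 ^ k) = x ^+ (4 ^ k) + y ^+ (4 ^ k).
Proof.
apply: exprDn_pchar; rewrite -[4%N]/(2 ^ 2)%N -expnM.
by rewrite pnatX (eq_pnat _ (pcharf_eq char2)) pnat_id.
Qed.

Let addxx (x : F) : x + x = 0. Proof. exact: addrr_pchar2. Qed.

Let expqq (x : F) : x ^+ q ^+ q = x.
Proof. by rewrite -exprM mulnn -cardF expf_card. Qed.

Definition fixq := [set b : F | b ^+ q == b].
Definition trq_fiber (e : F) := [set t : F | t ^+ q + t == e].

Let addr_eq (x y : F) : (x + y == 0) = (x == y).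
Proof. by rewrite addr_eq0 oppr_pchar2. Qed.

Lemma fixqE : fixq = trq_fiber 0.
Proof. by apply/setP=> b; rewrite !inE addr_eq. Qed.

Lemma trq_fix t : t ^+ q + t \in fixq.
Proof. by rewrite inE exprDq expqq addrC. Qed.

Lemma normq_fix a : a ^+ q.+1 \in fixq.
Proof. by rewrite inE exprS exprMn expqq mulrC. Qed.

Lemma card_trq_fiber_le e : (#|trq_fiber e| <= q)%N.
Proof.
pose f : {poly F} := 'X^q + ('X - e%:P).
have size_f : size f = q.+1.
  by rewrite size_polyDl size_polyXn // size_XsubC ltnS.
have f_neq0 : f != 0 by rewrite -size_poly_eq0 size_f.
rewrite cardE -ltnS -size_f; apply: max_poly_roots f_neq0 _ (enum_uniq _).
apply/allP=> t; rewrite mem_enum inE rootE hornerD hornerXn hornerXsubC => /eqP <-.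
by rewrite addrA subrr.
Qed.

(** The map t -> t^q + t has values in fixq, which is its fibre at 0; no fibre has
more than q elements, and the fibres over fixq cover the q^2 elements of F.  So
there are exactly q fibres, each of size q. *)
Lemma card_trq_fiber e : e \in fixq -> #|trq_fiber e| = q.
Proof.
move=> Ee; apply/eqP; rewrite eqn_leq card_trq_fiber_le /=.
have : (q ^ 2 <= #|trq_fiber e| + (q - 1) * q)%N.
  rewrite -cardF -[#|F|]sum1_card.
  rewrite (partition_big (fun t => t ^+ q + t) (mem fixq)) /=; last first.
    by move=> t _; apply: trq_fix.
  rewrite (bigD1 e) //= sum1dep_card; apply: leq_add => //.
  apply: (@leq_trans (\sum_(e' in fixq :\ e) q)).
    rewrite [leqRHS](eq_bigl (fun e' => (e' \in fixq) && (e' != e))) => [|e'];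
      last by rewrite in_setD1 andbC.
    apply: leq_sum => e' _; rewrite sum1dep_card; exact: card_trq_fiber_le.
  rewrite sum_nat_const leq_mul2r; apply/orP; right.
  by rewrite leq_subRL // -[1%N]/(true : nat) -Ee -cardsD1 fixqE card_trq_fiber_le.
by rewrite -[X in _ -> is_true X](leq_add2r ((q - 1) * q)) -mulSn subn1 prednK // mulnn.
Qed.

Lemma card_fixq : #|fixq| = q.
Proof. by rewrite fixqE card_trq_fiber // inE expr0n gtn_eqF. Qed.

Lemma trq_onto e : e \in fixq -> exists t, t ^+ q + t = e.
Proof.
move=> Ee; have /card_gt0P[t] : (0 < #|trq_fiber e|)%N by rewrite card_trq_fiber.
by rewrite inE => /eqP; exists t.
Qed.

(** * The three kinds of permutations of F x F *)

(** Right translation in the group F x F with (u, v)(a, b) = (u + a, v + b + u^q a);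
realizing G by permutations makes the group laws automatic. *)
Definition transl_fun (x u : F * F) : F * F :=
  (u.1 + x.1, u.2 + x.2 + u.1 ^+ q * x.1).
Definition scale_fun (c : {unit F}) (u : F * F) : F * F :=
  (val c * u.1, val c ^+ q.+1 * u.2).
Definition frob_fun (u : F * F) : F * F := (u.1 ^+ 4, u.2 ^+ 4).

Fact transl_fun_inj x : injective (transl_fun x).
Proof.
by case=> [u v] [u' v'] [/addIr-> /addIr/addIr->].
Qed.

Fact scale_fun_inj c : injective (scale_fun c).
Proof.
have c_neq0 : val c != 0 by rewrite -unitfE (valP c).
by case=> [u v] [u' v'] [/(mulfI c_neq0)-> /(mulfI (expf_neq0 _ c_neq0))->].
Qed.

Fact frob_fun_inj : injective frob_fun.
Proof.
have inj4 : injective (fun x : F => x ^+ 4).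
  move=> x y /= eq4; apply/eqP; rewrite -addr_eq.
  suff : (x + y) ^+ 4 == 0 by rewrite expf_eq0.
  by rewrite (exprD4 1) eq4 addxx.
by case=> [u v] [u' v'] [/inj4-> /inj4->].
Qed.

Definition transl x := perm (@transl_fun_inj x).
Definition scale c := perm (@scale_fun_inj c).
Definition frob := perm frob_fun_inj.

Lemma translM x y :
  (transl x * transl y)%g = transl (x.1 + y.1, x.2 + y.2 + x.1 ^+ q * y.1).
Proof.
apply/permP=> u; rewrite permM !permE /transl_fun /= exprDq.
by congr (_, _); ring.
Qed.

Lemma transl_inj : injective transl.
Proof.
move=> x y /permP/(_ (0, 0)); rewrite !permE /transl_fun /=.
by rewrite expr0n gtn_eqF // !mul0r !addr0 !add0r; case: x y => [? ?] [? ?].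
Qed.

Lemma translJscale x c :
  (transl x ^ scale c)%g = transl (val c * x.1, val c ^+ q.+1 * x.2).
Proof.
apply: (mulgI (scale c)); rewrite -conjgC.
apply/permP=> u; rewrite !permM !permE /transl_fun /scale_fun /= exprMn exprS.
by congr (_, _); ring.
Qed.

Lemma translJfrob x : (transl x ^ frob)%g = transl (x.1 ^+ 4, x.2 ^+ 4).
Proof.
apply: (mulgI frob); rewrite -conjgC.
apply/permP=> u; rewrite !permM !permE /transl_fun /frob_fun /=.
by rewrite !(exprD4 1) exprMn (exprAC _ 4 q).
Qed.

Lemma scaleM c d : scale (c * d)%g = (scale c * scale d)%g.
Proof.
apply/permP=> u; rewrite permM !permE /scale_fun /= exprMn.
by congr (_, _); ring.
Qed.

Lemma scale1 : scale 1%g = 1%g.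
Proof. by apply: (mulgI (scale 1%g)); rewrite -scaleM !mulg1. Qed.

Lemma scaleX c k : (scale c ^+ k)%g = scale (c ^+ k)%g.
Proof. by elim: k => [|k IHk]; rewrite ?scale1 // !expgS IHk scaleM. Qed.

Lemma scale_inj : injective scale.
Proof.
move=> c d /permP/(_ (1, 0)); rewrite !permE /scale_fun /= !mulr1 => -[eq_cd _].
exact: val_inj.
Qed.

Lemma scaleJfrob c : (scale c ^ frob)%g = scale (c ^+ 4)%g.
Proof.
apply: (mulgI frob); rewrite -conjgC.
apply/permP=> u; rewrite !permM !permE /scale_fun /frob_fun FinRing.val_unitX /=.
by rewrite !exprMn; congr (_, _ * _); apply: exprAC.
Qed.

Lemma frobX k u : (frob ^+ k)%g u = (u.1 ^+ (4 ^ k), u.2 ^+ (4 ^ k)).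
Proof.
elim: k u => [|k IHk] u; first by rewrite perm1 !expr1; case: u.
by rewrite expgSr permM IHk permE /frob_fun /= -!exprM -!expnSr.
Qed.

(** * The Sylow 2-subgroup of SU(3, q) *)

Definition heis_coords := [set x : F * F | x.2 ^+ q + x.2 == x.1 ^+ q.+1].
Definition heis := [set transl x | x in heis_coords].
Definition heis_center := [set transl (0, b) | b in fixq].

Lemma mem_heis x : (transl x \in heis) = (x.2 ^+ q + x.2 == x.1 ^+ q.+1).
Proof. by rewrite mem_imset ?inE //; apply: transl_inj. Qed.

Lemma mem_heis_center x : (transl x \in heis_center) = (x.1 == 0) && (x.2 \in fixq).
Proof.
apply/imsetP/andP=> [[b Eb /transl_inj->] | [/eqP x1 Ex2]]; first by rewrite eqxx.
by exists x.2; rewrite // -x1; case: x {x1 Ex2}.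
Qed.

Lemma transl0 : transl (0, 0) = 1%g.
Proof.
by apply: (mulgI (transl (0, 0))); rewrite translM /= expr0n gtn_eqF // mul0r !addr0 mulg1.
Qed.

Fact heis_group_set : group_set heis.
Proof.
apply/group_setP; split.
  by rewrite -transl0 mem_heis /= !expr0n gtn_eqF //= addr0.
move=> _ _ /imsetP[x + ->] /imsetP[y + ->]; rewrite !inE => /eqP Hx /eqP Hy.
rewrite translM mem_heis /= exprS !exprDq exprMn expqq; apply/eqP.
transitivity ((x.2 ^+ q + x.2) + (y.2 ^+ q + y.2) + (x.1 * y.1 ^+ q + x.1 ^+ q * y.1)).
  by ring.
by rewrite Hx Hy !exprS; ring.
Qed.
Canonical heis_group := Group heis_group_set.

Fact heis_center_group_set : group_set heis_center.
Proof.
apply/group_setP; split.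
  by rewrite -transl0 mem_heis_center eqxx inE expr0n gtn_eqF //=.
move=> _ _ /imsetP[a + ->] /imsetP[b + ->]; rewrite !inE => /eqP Ha /eqP Hb.
by rewrite translM mem_heis_center /= mulr0 !addr0 eqxx inE exprDq Ha Hb /=.
Qed.
Canonical heis_center_group := Group heis_center_group_set.

Lemma card_heis_center : #|heis_center| = q.
Proof. by rewrite card_imset ?card_fixq // => a b /transl_inj[]. Qed.

Lemma heis_center_sub : heis_center \subset heis.
Proof.
apply/subsetP=> _ /imsetP[b + ->]; rewrite inE => /eqP Eb.
by rewrite mem_heis /= Eb addxx expr0n.
Qed.

Lemma card_heis : #|heis| = (q ^ 3)%N.
Proof.
rewrite card_imset; last exact: transl_inj.
rewrite -sum1dep_card.
rewrite (eq_bigl (fun x => true && (x.2 \in trq_fiber (x.1 ^+ q.+1)))) => [|x]; last first.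
  by rewrite inE.
rewrite -(pair_big_dep xpredT (fun a b => b \in trq_fiber (a ^+ q.+1)) (fun _ _ => 1%N)) /=.
rewrite (eq_bigr (fun=> q)) => [|a _]; last by rewrite sum1_card card_trq_fiber ?normq_fix.
by rewrite sum_nat_const cardF -expnSr.
Qed.

Lemma index_heis_center : #|heis : heis_center| = (q ^ 2)%N.
Proof.
apply/eqP; rewrite -(eqn_pmul2l q_gt0) -{1}card_heis_center Lagrange ?heis_center_sub //.
by rewrite card_heis expnS.
Qed.

Lemma translR x y :
  [~ transl x, transl y]%g = transl (0, x.1 ^+ q * y.1 + y.1 ^+ q * x.1).
Proof.
apply: (mulgI (transl x)); rewrite commgEl mulKVg.
apply: (mulgI (transl y)); rewrite -conjgC !translM /= addr0 mulr0 addr0.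
congr (transl (_, _)); first exact: addrC.
by rewrite -[LHS]addr0 -(addxx (y.1 ^+ q * x.1)); ring.
Qed.

Lemma heis_center_central : heis_center \subset 'Z(heis).
Proof.
rewrite subsetI heis_center_sub; apply/subsetP=> _ /imsetP[b Eb ->].
apply/centP=> _ /imsetP[x _ ->]; apply/commgP/eqP.
by rewrite translR /= mulr0 expr0n gtn_eqF // mul0r addr0 transl0.
Qed.

Lemma der1_heis : heis^`(1)%g \subset heis_center.
Proof.
rewrite gen_subG; apply/subsetP=> _ /imset2P[_ _ /imsetP[x _ ->] /imsetP[y _ ->] ->].
rewrite translR mem_heis_center eqxx inE exprDq !exprMn !expqq /=.
by rewrite addrC [X in X + _]mulrC [X in _ + X]mulrC.
Qed.

(** In coordinates the commutator of (x1, x2) and (y1, y2) is the trace of x1^q y1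
from F to its subfield of order q, and the trace is onto. *)
Lemma heis_camina x z : x \in heis -> x \notin heis_center -> z \in heis_center ->
  exists2 y, y \in heis & [~ x, y]%g = z.
Proof.
case/imsetP=> {}x Hx ->; rewrite mem_heis_center negb_and => notZx.
case/imsetP=> e Ee ->.
have x1_neq0 : x.1 != 0.
  apply: contraTneq Hx => x1; rewrite x1 eqxx /= in notZx.
  by rewrite inE x1 expr0n /= addr_eq; rewrite inE in notZx.
have [t Dt] := trq_onto Ee.
have [b Db] := trq_onto (normq_fix (t / x.1 ^+ q)).
exists (transl (t / x.1 ^+ q, b)); first by rewrite mem_heis /= Db.
rewrite translR /= -Dt mulrC divfK ?expf_neq0 // addrC; congr (transl (_, _ + _)).
by rewrite exprMn exprVn expqq divfK.
Qed.

Lemma heis_normJscale c : scale c \in 'N(heis)%g.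
Proof.
rewrite inE; apply/subsetP=> _ /imsetP[_ /imsetP[x + ->] ->].
rewrite inE translJscale mem_heis /= [in X in X -> _]eq_sym => /eqP Hx.
rewrite !exprMn Hx (eqP (_ : val c ^+ q.+1 ^+ q == val c ^+ q.+1)) -?mulrDr //.
by have := normq_fix (val c); rewrite inE.
Qed.

Lemma heis_center_normJscale c : scale c \in 'N(heis_center)%g.
Proof.
rewrite inE; apply/subsetP=> _ /imsetP[_ /imsetP[b + ->] ->].
rewrite inE => /eqP Eb; rewrite translJscale mem_heis_center /= mulr0 eqxx inE.
have := normq_fix (val c); rewrite inE => /eqP cq.
by rewrite exprMn Eb cq /=.
Qed.

Lemma heis_normJfrob : frob \in 'N(heis)%g.
Proof.
rewrite inE; apply/subsetP=> _ /imsetP[_ /imsetP[x + ->] ->].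
rewrite inE translJfrob mem_heis /= => /eqP Hx.
by rewrite [x.2 ^+ 4 ^+ q]exprAC [x.1 ^+ 4 ^+ q.+1]exprAC -Hx (exprD4 1).
Qed.

Lemma heis_center_normJfrob : frob \in 'N(heis_center)%g.
Proof.
rewrite inE; apply/subsetP=> _ /imsetP[_ /imsetP[b + ->] ->].
rewrite inE => /eqP Eb; rewrite translJfrob mem_heis_center /= expr0n eqxx inE.
by rewrite exprAC Eb /=.
Qed.

(** On P / Z, identified with F, the map y -> [y, c] is multiplication by c - 1,
which is c + 1 in characteristic 2. *)
Lemma scale_moves_heis c x : c != 1%g -> x \in heis ->
  exists2 y, y \in heis & (x * [~ y, scale c]^-1)%g \in heis_center.
Proof.
move=> c_neq1 /imsetP[{}x + ->]; rewrite inE => Hx.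
have c1_neq0 : val c + 1 != 0.
  by rewrite addr_eq; apply: contra c_neq1 => /eqP c1; apply/eqP/val_inj.
have [b Db] := trq_onto (normq_fix (x.1 / (val c + 1))).
set y := (x.1 / (val c + 1), b).
have Hy : transl y \in heis by rewrite mem_heis /= Db.
have Dx1 : x.1 = val c * y.1 + y.1.
  by rewrite /y /= -[X in _ + X]mul1r -mulrDl mulrCA divff // mulr1.
exists (transl y) => //; clearbody y.
have [k Hk Dk] : exists2 k, k \in heis_coords & [~ transl y, scale c]%g = transl k.
  apply/imsetP; rewrite commgEl; apply: groupM (groupVr Hy) _.
  by rewrite memJ_norm ?heis_normJscale.
have k1 : k.1 = x.1.
  have : (transl y * transl k = transl y ^ scale c)%g by rewrite -Dk commgEl mulKVg.
  rewrite translM translJscale => /transl_inj[/= /eqP + _].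
  rewrite -addr_eq => /eqP yk; apply/eqP; rewrite -addr_eq -yk; apply/eqP.
  by rewrite Dx1 /=; ring.
have [m Hm Dm] : exists2 m, m \in heis_coords & (transl x * (transl k)^-1)%g = transl m.
  have Px : transl x \in heis by rewrite mem_heis.
  have Pk : transl k \in heis by rewrite mem_heis; rewrite inE in Hk.
  by apply/imsetP; apply: groupM Px (groupVr Pk).
rewrite Dk Dm mem_heis_center.
have m1 : m.1 = 0.
  have : (transl m * transl k = transl x)%g by rewrite -Dm mulgKV.
  by rewrite translM => /transl_inj/(congr1 fst) /=; rewrite k1 =>
    /(canRL (addrK _)); rewrite subrr.
by rewrite m1 eqxx inE; rewrite inE m1 expr0n /= addr_eq in Hm.
Qed.

(** On Z the map y -> [y, c] is multiplication by c^(q+1) - 1. *)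
Lemma scale_moves_center c z : val c ^+ q.+1 != 1 -> z \in heis_center ->
  exists2 y, y \in heis_center & [~ y, scale c]%g = z.
Proof.
move=> nc /imsetP[e + ->]; rewrite inE => /eqP Ee.
have n_neq0 : val c ^+ q.+1 + 1 != 0 by rewrite addr_eq.
have := normq_fix (val c); rewrite inE => /eqP cq.
exists (transl (0, e / (val c ^+ q.+1 + 1))).
  by rewrite mem_heis_center eqxx inE exprMn exprVn exprDq cq Ee expr1n /=.
rewrite commgEl; apply: (mulgI (transl (0, e / (val c ^+ q.+1 + 1)))).
rewrite mulKVg translJscale translM /= !mulr0 !addr0.
congr (transl (_, _)).
rewrite -[LHS]addr0 -(addxx (e / (val c ^+ q.+1 + 1))) addrA -[X in _ + X + _]mul1r -mulrDl.
by rewrite mulrCA divff // mulr1 addrC.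
Qed.

Lemma scale_cents_center c : val c ^+ q.+1 = 1 -> scale c \in 'C(heis_center)%g.
Proof.
move=> nc; apply/centP=> _ /imsetP[b _ ->]; apply/commute_sym/commgP/conjg_fixP.
by rewrite translJscale /= nc mulr0 mul1r.
Qed.

(** * The group and its degrees *)

(** An element c of order q + 1 satisfies c^(4^k) = c only if 4^k = 1 modulo
q + 1.  This gives both the order of the field automorphism and the fact that only
the identity of K centralizes D. *)
Lemma frob_order_dvd c k : #[c]%g = q.+1 ->
  commute (frob ^+ k)%g (scale c) -> (N %| k)%N.
Proof.
move=> o_c comm_k; apply: dvdn_pow4_eq1 => //; apply/eqP.
rewrite -o_c -eq_expg_mod_order expg1; apply/eqP/scale_inj.
have conjX : (scale c ^ (frob ^+ k))%g = scale (c ^+ (4 ^ k))%g.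
  elim: k {comm_k} => [|k IHk]; first by rewrite conjg1 expg1.
  by rewrite expgSr conjgM IHk scaleJfrob -expgM -expnSr.
by rewrite -conjX; apply/conjg_fixP/commgP/commute_sym.
Qed.

Lemma frobN : (frob ^+ N)%g = 1%g.
Proof.
apply/permP=> u; rewrite frobX perm1.
have -> : (4 ^ N)%N = #|F| by rewrite cardF /q -[4%N]/(2 ^ 2)%N -!expnM mulnC.
by rewrite !expf_card; case: u.
Qed.

Theorem exists_frob_heis_group : odd N -> coprime N (q ^ 2).-1 ->
  exists (gT : finGroupType) (G : {group gT}),
    [/\ solvable G,
        forall a, a \in cd G -> (a %| q * q.-1 * N)%N \/ a = (q ^ 2).-1,
        (q * q.-1 * N)%N \in cd G & (q ^ 2).-1 \in cd G].
Proof.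
move=> oddN coN.
have /cyclicP[w defU] : cyclic [set: {unit F}] by apply: field_unit_group_cyclic.
have sqr_q : (q ^ 2).-1 = (q.-1 * q.+1)%N.
  by rewrite -(subn1 (q ^ 2)) -[X in (_ - X)%N](exp1n 2) subn_sqr addn1 subn1.
have q1_gt0 : (0 < q.-1)%N by rewrite -subn1 subn_gt0.
have o_w : #[w]%g = (q ^ 2).-1 by rewrite /order -defU card_finField_unit cardF.
have orderS c : #[scale c]%g = #[c]%g.
  have scaleX1 k : (scale c ^+ k == 1)%g = (c ^+ k == 1)%g.
    by rewrite scaleX -scale1 (inj_eq scale_inj).
  apply/eqP; rewrite eqn_dvd !order_dvdn scaleX1 expg_order -scaleX1.
  by rewrite expg_order !eqxx.
pose P := [group of heis]; pose Z := [group of heis_center].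
pose C := <[scale w]>%G; pose d := (w ^+ q.-1)%g; pose D := <[scale d]>%G.
pose K := <[frob]>%G; pose H := (C <*> K)%G; pose G := (P <*> H)%G.
have CP h : h \in C -> exists c, h = scale c.
  by case/cycleP=> k ->; rewrite scaleX; exists (w ^+ k)%g.
have memC c : scale c \in C.
  have /cycleP[k ->] : c \in <[w]>%g by rewrite -defU inE.
  by rewrite -scaleX mem_cycle.
have o_d : #[d]%g = q.+1.
  by rewrite orderXdiv o_w sqr_q ?dvdn_mulr // mulKn.
(* D, the subgroup of order q + 1, is the kernel of the norm c -> c^(q+1). *)
have memD c : scale c \in D = (val c ^+ q.+1 == 1).
  have -> : (val c ^+ q.+1 == 1) = (c ^+ q.+1 == 1)%g.
    by rewrite -(inj_eq val_inj) /= FinRing.val_unitX.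
  apply/cycleP/eqP=> [[k] | cq1].
    rewrite scaleX => /scale_inj->; rewrite -expgM mulnC expgM -o_d.
    by rewrite expg_order expg1n.
  have /cycleP[k Dc] : c \in <[w]>%g by rewrite -defU inE.
  have /dvdnP[j Dk] : (q.-1 %| k)%N.
    move/eqP: cq1; rewrite Dc -expgM -order_dvdn o_w sqr_q.
    by rewrite dvdn_pmul2r.
  by exists j; rewrite scaleX Dc Dk mulnC expgM.
have o_frob : #[frob]%g = N.
  apply/eqP; rewrite eqn_dvd order_dvdn frobN eqxx /=.
  by apply: frob_order_dvd o_d _; rewrite expg_order; apply/commute_sym/commute1.
have nCK : K \subset 'N(C)%g.
  rewrite cycle_subG inE; apply/subsetP=> _ /imsetP[_ /CP[c ->] ->].
  by rewrite scaleJfrob memC.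
have tiCK : (C :&: K = 1)%g.
  apply/trivgP/subsetP=> _ /setIP[/CP[c ->] /cycleP[k Dk]]; rewrite inE.
  have := congr1 (fun s : {perm F * F} => s (1, 0)) Dk.
  rewrite permE frobX /scale_fun /= mulr1 expr1n => -[c1 _].
  by rewrite -scale1; apply/eqP; congr scale; apply: val_inj.
have defH : (C ><| K)%g = H by apply: sdprodEY.
have nPH : H \subset 'N(P)%g.
  by rewrite join_subG !cycle_subG heis_normJscale heis_normJfrob.
have nZH : H \subset 'N(Z)%g.
  by rewrite join_subG !cycle_subG heis_center_normJscale heis_center_normJfrob.
have HP h : h \in H -> exists c k, h = (scale c * frob ^+ k)%g.
  case/(mem_sdprod defH) => s [t [/CP[c ->] /cycleP[k ->] -> _]]; by exists c, k.
have tiPH : (P :&: H = 1)%g.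
  apply/trivgP/subsetP=> _ /setIP[/imsetP[x _ ->] /HP[c [k Dx]]]; rewrite inE.
  have tr0 : transl x (0, 0) = x.
    by rewrite permE /transl_fun /= expr0n gtn_eqF // mul0r addr0 !add0r; case: x {Dx}.
  have fix0 : (scale c * frob ^+ k)%g (0, 0) = (0, 0).
    by rewrite permM frobX permE /scale_fun /= !mulr0 expr0n expn_eq0.
  by rewrite -transl0 -tr0 Dx fix0.
have defG : (P ><| H)%g = G by apply: sdprodEY.
have cardC : #|C| = (q ^ 2).-1 by rewrite -o_w -orderS.
have cardD : #|D| = q.+1 by rewrite -o_d -orderS.
have cardK : #|K| = N by [].
have sDC : D \subset C by rewrite cycle_subG memC.
have cDZ : D \subset 'C(Z)%g.
  by rewrite cycle_subG; apply/scale_cents_center/eqP; rewrite -memD cycle_id.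
have sCD : ('C_H(D) \subset C)%g.
  apply/subsetP=> h /setIP[/HP[c [k ->]] /centP cD]; rewrite groupMl ?memC //.
  have comm_k : commute (frob ^+ k)%g (scale d).
    have comm_ck := cD _ (cycle_id (scale d)).
    have comm_c : commute (scale c) (scale d).
      by rewrite /commute -!scaleM; congr scale; apply: val_inj; apply: mulrC.
    apply: (mulgI (scale c)); rewrite mulgA comm_ck !mulgA.
    by rewrite comm_c.
  have /dvdnP[j ->] := frob_order_dvd o_d comm_k.
  by rewrite mulnC expgM frobN expg1n group1.
have coCK : coprime #|C| #|K| by rewrite cardC cardK coprime_sym.
have coPH : coprime #|P| #|H|.
  rewrite -(sdprod_card defH) cardC cardK card_heis /q -!expnM coprimeXl //.
  rewrite coprime2n oddM oddN andbT -subn1 oddB ?expn_gt0 //.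
  by rewrite oddX -/(1 ^ 2)%N addbT muln_eq0 gtn_eqF.
have camP := heis_camina.
have movP c x : c \in C -> c != 1%g -> x \in P ->
    exists2 y, y \in P & (x * [~ y, c]^-1)%g \in Z.
  move=> /CP[{}c ->] nc; apply: scale_moves_heis; apply: contraNneq nc => ->.
  by rewrite scale1.
have movZ c z : c \in C -> c \notin D -> z \in Z -> exists2 y, y \in Z & [~ y, c]%g = z.
  by move=> /CP[{}c ->]; rewrite memD; apply: scale_moves_center.
have abK : abelian K := cycle_abelian frob.
have cycC : cyclic C := cycle_cyclic (scale w).
exists {perm F * F}, G; split.
- have nsPG : P <| G by case/sdprod_context: defG.
  have nsCH : C <| H by case/sdprod_context: defH.
  rewrite (series_sol nsPG) -(isog_sol (sdprod_isog defG)).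
  rewrite (series_sol nsCH) -(isog_sol (sdprod_isog defH)).
  rewrite (abelian_sol (cyclic_abelian cycC)) (abelian_sol abK).
  rewrite !andbT; apply: (@pgroup_sol _ 2).
  by rewrite /pgroup card_heis pnatX pnatX pnat_id.
- move=> a.
  rewrite -cardK.
  exact: (cd_semidirect_cases defG defH heis_center_central der1_heis nZH cycC abK sDC cDZ
    coPH coCK q_gt1 card_heis_center index_heis_center cardC cardD camP movP movZ).
- rewrite -cardK.
  exact: (cd_semidirect_top defG defH heis_center_central der1_heis nZH cycC abK sDC cDZ sCD
    coPH coCK q_gt1 card_heis_center index_heis_center cardC cardD camP movZ).
exact: (cd_semidirect_quo defG defH heis_center_central der1_heis nZH cycC abK
    coPH q_gt1 index_heis_center cardC movP).
Qed.

End Model.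

(** * The graph *)

Local Open Scope nat_scope.

Lemma prime_dvd_prod_codom m (f : 'I_m -> nat) x :
  prime x -> (forall j, prime (f j)) -> (x %| \prod_(j < m) f j) = (x \in codom f).
Proof.
move=> pr_x pr_f; apply/idP/codomP=> [|[j ->]].
  rewrite Euclid_dvd_prod // big_orE => /existsP[j dv].
  by exists j; apply/eqP; rewrite -dvdn_prime2.
by rewrite (bigD1 j) //= dvdn_mulr.
Qed.

Lemma dvd3_pow2_odd N : odd N -> 3 %| 2 ^ N + 1.
Proof.
move=> oddN; rewrite -[N]odd_double_half oddN expnS -mul2n expnM /dvdn.
by rewrite -modnDml -modnMmr -modnXm exp1n.
Qed.

Lemma exists_solvable_cd_pow2 N : 0 < N -> odd N -> coprime N ((2 ^ N) ^ 2).-1 ->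
  exists (gT : finGroupType) (G : {group gT}),
    [/\ solvable G,
        forall a, a \in cd G -> a %| 2 ^ N * (2 ^ N).-1 * N \/ a = ((2 ^ N) ^ 2).-1,
        2 ^ N * (2 ^ N).-1 * N \in cd G & ((2 ^ N) ^ 2).-1 \in cd G].
Proof.
move=> N_gt0 oddN coN.
have [|F char2 cardF] := @pPrimePowerField 2 (N * 2) isT; first by rewrite muln_gt0 N_gt0.
by apply: (@exists_frob_heis_group F) => //; rewrite cardF expnM.
Qed.

Theorem mainTheorem1 (n m k : nat)
    (p : 'I_n -> nat) (q : 'I_m -> nat) (r : 'I_k -> nat)
    (n_ge1 : 1 <= n)
    (p_prime : forall i, prime (p i))
    (p_inj : injective p)
    (p_neq23 : forall i, p i <> 2 /\ p i <> 3)
    (q_prod : 2 ^ (\prod_(i < n) p i) - 1 = \prod_(j < m) q j)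
    (r_prod : (2 ^ (\prod_(i < n) p i) + 1) %/ 3 = \prod_(l < k) r l)
    (q_prime : forall j, prime (q j))
    (r_prime : forall l, prime (r l))
    (q_inj : injective q)
    (r_inj : injective r)
    (q_neq_r : forall j l, q j <> r l)
    (q_neq23 : forall j, q j <> 2 /\ q j <> 3)
    (r_neq23 : forall l, r l <> 2 /\ r l <> 3)
    (q_neq_p : forall j i, q j <> p i)
    (r_neq_p : forall l i, r l <> p i) :
  let V := [:: 2; 3] ++ codom p ++ codom q ++ codom r in
  let A := 2 :: codom p ++ codom q in
  let B := 3 :: codom r ++ codom q in
  [/\ uniq V, size V = n + m + k + 2
    & exists (gT : finGroupType) (G : {group gT}),
      [/\ solvable G,
          forall x : nat, Delta_vertex G x <-> x \in V
        & forall x y : nat, Delta_adj G x y <->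
            x <> y /\ ((x \in A /\ y \in A) \/ (x \in B /\ y \in B))]].
Proof.
set N := \prod_(i < n) p i in q_prod r_prod *.
have mem_p x : prime x -> (x %| N) = (x \in codom p) by move/prime_dvd_prod_codom->.
have N_gt0 : 0 < N by apply: prodn_gt0 => i; apply: prime_gt0.
have notdvd_N x : prime x -> x \notin codom p -> ~~ (x %| N) by move=> pr_x; rewrite mem_p.
have p2 : 2 \notin codom p by apply/codomP=> -[i /esym]; case: (p_neq23 i).
have p3 : 3 \notin codom p by apply/codomP=> -[i /esym]; case: (p_neq23 i).
have q2 : 2 \notin codom q by apply/codomP=> -[j /esym]; case: (q_neq23 j).
have q3 : 3 \notin codom q by apply/codomP=> -[j /esym]; case: (q_neq23 j).
have r2 : 2 \notin codom r by apply/codomP=> -[l /esym]; case: (r_neq23 l).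
have r3 : 3 \notin codom r by apply/codomP=> -[l /esym]; case: (r_neq23 l).
have oddN : odd N by have := notdvd_N 2 isT p2; rewrite dvdn2 negbK.
move=> V A B.
have B_eq : ((2 ^ N) ^ 2).-1 = 3 * \prod_(l < k) r l * \prod_(j < m) q j.
  rewrite -r_prod -q_prod mulnC [3 * _]mulnC divnK ?dvd3_pow2_odd //.
  by rewrite -subn1 -[X in _ - X](exp1n 2) subn_sqr.
have memB x : prime x -> (x %| ((2 ^ N) ^ 2).-1) = (x \in B).
  move=> pr_x; rewrite B_eq !Euclid_dvdM // !prime_dvd_prod_codom //.
  by rewrite (dvdn_prime2 pr_x (isT : prime 3)) inE mem_cat orbA.
have memA x : prime x -> (x %| 2 ^ N * (2 ^ N).-1 * N) = (x \in A).
  move=> pr_x; rewrite !Euclid_dvdM // Euclid_dvdX // N_gt0 andbT.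
  rewrite -[(2 ^ N).-1]subn1 q_prod (mem_p x) // prime_dvd_prod_codom //.
  by rewrite (dvdn_prime2 pr_x (isT : prime 2)) inE mem_cat -orbA [X in _ || X]orbC.
have prA x : x \in A -> prime x.
  by rewrite inE mem_cat => /or3P[/eqP-> // | /codomP[? ->] | /codomP[? ->]].
have prB x : x \in B -> prime x.
  by rewrite inE mem_cat => /or3P[/eqP-> // | /codomP[? ->] | /codomP[? ->]].
have coN : coprime N ((2 ^ N) ^ 2).-1.
  rewrite coprime_sym coprime_has_primes //; last first.
    by rewrite -ltnS prednK ?expn_gt0 // -(exp1n 2) ltn_exp2r // -(expn0 2) ltn_exp2l.
  apply/hasPn=> x; rewrite !mem_primes => /and3P[pr_x _ x_N].
  move: x_N; rewrite mem_p // => x_N.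
  apply/negP=> /and3P[_ _]; rewrite memB // inE mem_cat =>
    /or3P[/eqP x3 | /codomP[l xr] | /codomP[j xq]].
  - by rewrite -x3 x_N in p3.
  - by have /codomP[i xp] := x_N; apply: (r_neq_p l i); rewrite -xr.
  - by have /codomP[i xp] := x_N; apply: (q_neq_p j i); rewrite -xq.
have [gT [G [solG cdG cdA cdB]]] := exists_solvable_cd_pow2 N_gt0 oddN coN.
split.
- rewrite /V /= inE !mem_cat !negb_or p2 p3 q2 q3 r2 r3 /=.
  have uniq_codom s (f : 'I_s -> nat) : injective f -> uniq (codom f).
    by move=> f_inj; rewrite map_inj_uniq ?enum_uniq.
  rewrite !cat_uniq !uniq_codom //= has_cat negb_or andbT -?andbA.
  apply/and3P; split.
  + apply/hasPn=> _ /codomP[j ->]; apply/codomP=> -[i]; exact: q_neq_p.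
  + apply/hasPn=> _ /codomP[l ->]; apply/codomP=> -[i]; exact: r_neq_p.
  apply/hasPn=> _ /codomP[l ->]; apply/codomP=> -[j /esym]; exact: q_neq_r.
- by rewrite /V /= !size_cat !size_codom !card_ord addn2 addnA.
exists gT, G.
have memV x : (x \in V) = (x \in A) || (x \in B).
  rewrite /V /A /B !(inE, mem_cat).
  by do ![case: (_ == _) | case: (_ \in _)].
have vertexE x : Delta_vertex G x <-> x \in V.
  rewrite memV; split=> [[pr_x [a /cdG[dv | ->] x_a]] | /orP[Ax | Bx]].
  - by rewrite -memA // (dvdn_trans x_a dv).
  - by rewrite -(memB x) // x_a orbT.
  - have pr_x := prA x Ax; split=> //.
    by exists (2 ^ N * (2 ^ N).-1 * N); rewrite ?memA.
  have pr_x := prB x Bx; split=> //.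
  by exists ((2 ^ N) ^ 2).-1; rewrite ?memB.
split=> // x y; split=> [[[pr_x _] [pr_y _] neq_xy [b cd_b xy_b]] | [neq_xy AB]].
  split=> //; have [x_b y_b] : x %| b /\ y %| b.
    by split; apply: dvdn_trans xy_b; [apply: dvdn_mulr | apply: dvdn_mull].
  case: (cdG b cd_b) => [dv | b_eq]; [left | right].
    by rewrite -!memA // !(dvdn_trans _ dv).
  by rewrite -!memB // -b_eq.
have dvd2 d : prime x -> prime y -> x %| d -> y %| d -> x * y %| d.
  move=> pr_x pr_y x_d y_d; rewrite Gauss_dvd ?x_d //.
  by rewrite prime_coprime // dvdn_prime2 //; apply/eqP.
have [Vx Vy] : x \in V /\ y \in V.
  by rewrite !memV; case: AB => -[-> ->]; rewrite ?orbT.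
split=> //; try exact/vertexE.
case: AB => -[Hx Hy].
  have [pr_x pr_y] := (prA x Hx, prA y Hy).
  by exists (2 ^ N * (2 ^ N).-1 * N); rewrite // dvd2 ?memA.
have [pr_x pr_y] := (prB x Hx, prB y Hy).
by exists ((2 ^ N) ^ 2).-1; rewrite // dvd2 ?memB.
Qed.
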